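(* A countable Polish Clifford semigroup $S$ embeds topologically into $I_{\mathbb{N}}$ if and only if $S$ is ditopological and the semilattice $E(S)$ embeds topologically into $I_{\mathbb{N}}$.
   Context: An inverse semigroup is a semigroup $S$ such that for each $x\in S$ there is a unique $x^{-1}\in S$ with $xx^{-1}x=x$ and $x^{-1}xx^{-1}=x^{-1}$. It is Clifford if $xx^{-1}=x^{-1}x$ for all $x\in S$. $E(S)=\{e\in S: e^2=e\}$ is the semilattice (commutative semigroup of idempotents) of idempotents of $S$, with the subspace topology. A topological semigroup is a semigroup with a topology for which multiplication is continuous (such a topology is called a semigroup topology). A Polish Clifford semigroup is a Clifford semigroup with a Polish (completely metrizable and separable) semigroup topology. An inverse semigroup $S$ with a semigroup topology is called ditopological if inversion is continuous and for any point $x\in S$ and any neighbourhood $O$ of $x$ there are neighbourhoods $U$ and $W$ of $x$ and $xx^{-1}$, respectively, such that $$\{s\in S : \exists b\in U,\ \exists e\in W\cap E(S)\text{ such that } b=es\}\cap\{s\in S : ss^{-1}\in W\}\subseteq O.$$ $I_{\mathbb{N}}$ is the symmetric inverse monoid of all partial permutations of $\mathbb{N}$ (bijections between subsets of $\mathbb{N}$) under composition of binary relations (functions act on the right and compose from left to right), with the topology generated by the subbasis consisting of the sets $U_{x,y}=\{h : (x,y)\in h\}$, $W_x=\{h : x\notin\operatorname{dom}(h)\}$ and $W_x^{-1}=\{h : x\notin\operatorname{im}(h)\}$, for $x,y\in\mathbb{N}$. An embedding of semigroups is an injective homomorphism; an embedding $\phi:S\to T$ of topological semigroups is topological if both $\phi$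 and $\phi^{-1}:(S)\phi\to S$ are continuous, where $(S)\phi$ has the subspace topology. ''$S$ embeds topologically into $T$'' means such a topological embedding exists. *)

(* Defs.v *)
From HB Require Import structures.
From mathcomp Require Import all_boot all_order all_algebra.
From mathcomp Require Import all_classical all_reals all_analysis.

Set Implicit Arguments.
Unset Strict Implicit.
Unset Printing Implicit Defensive.

Local Open Scope classical_set_scope.
Local Open Scope group_scope.

(* Library [semigroupType]s and [topologicalType]s may be empty, and so may the
   semigroups considered here. *)

#[short(type="preTopologicalSemigroupType")]
HB.structure Definition PreTopologicalSemigroup :=
  {S of Topological S & Semigroup S}.

HB.mixin Record PreTopologicalSemigroup_isTopologicalSemigroup S
    & PreTopologicalSemigroup S := {
  smul_continuous : continuous (fun z : S * S => z.1 * z.2)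
}.

#[short(type="topologicalSemigroupType")]
HB.structure Definition TopologicalSemigroup :=
  {S of PreTopologicalSemigroup S
      & PreTopologicalSemigroup_isTopologicalSemigroup S}.

(* [sinv] is determined by the multiplication, by uniqueness.  It is not the
   library's [_^-1], which presupposes a unit. *)
HB.mixin Record Semigroup_isInverse S & Semigroup S := {
  sinv : S -> S;
  mulgVKs : forall x : S, x * sinv x * x = x;
  mulVgKs : forall x : S, sinv x * x * sinv x = sinv x;
  sinv_uniq : forall x y : S, x * y * x = x -> y * x * y = y -> y = sinv x
}.

#[short(type="inverseSemigroupType")]
HB.structure Definition InverseSemigroup :=
  {S of Semigroup S & Semigroup_isInverse S}.

(* Continuity of [sinv] is not assumed. *)
#[short(type="inverseWithSemigroupTopologyType")]
HB.structure Definition InverseWithSemigroupTopology :=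
  {S of TopologicalSemigroup S & Semigroup_isInverse S}.

Definition clifford (S : inverseSemigroupType) : Prop :=
  forall x : S, x * sinv x = sinv x * x.

Definition idempotents (S : semigroupType) : set S := [set e | e * e = e].
Arguments idempotents : clear implicits.

Definition ditopological (S : inverseWithSemigroupTopologyType) : Prop :=
  continuous (@sinv S) /\
  forall (x : S) (O : set S), nbhs x O ->
    exists U W : set S, [/\ nbhs x U, nbhs (x * sinv x) W &
      [set s : S | exists b e : S, [/\ U b, (W `&` idempotents S) e & b = e * s]]
        `&` [set s : S | W (s * sinv s)] `<=` O].

Section Idempotents.
Variable S : inverseSemigroupType.
Implicit Types e f : S.

Lemma sinv_idem e : e * e = e -> sinv e = e.
Proof. by move=> ee; apply/esym/sinv_uniq; rewrite !ee. Qed.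

(* x := sinv (e f); then f x e is another inverse of e f, so x = f x e is
   idempotent, hence so is e f = sinv x. *)
Lemma mul_idem e f : e * e = e -> f * f = f -> (e * f) * (e * f) = e * f.
Proof.
move=> ee ff; pose x := sinv (e * f).
have efx : e * f * x * (e * f) = e * f := mulgVKs (e * f).
have xef : x * (e * f) * x = x := mulVgKs (e * f).
have fxe : f * x * e = x.
  apply: sinv_uniq.
    rewrite -[RHS]efx !mulgA -(mulgA _ f f) ff.
    by rewrite -(mulgA _ e e) ee.
  rewrite !mulgA -(mulgA _ e e) ee -(mulgA _ f f) ff.
  by rewrite -[in RHS]xef !mulgA.
have xx : x * x = x.
  have -> : x * x = f * (x * (e * f) * x) * e by rewrite -{1 2}fxe !mulgA.
  by rewrite xef.
have -> : e * f = x; last exact: xx.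
by rewrite -[RHS](sinv_idem xx); apply: sinv_uniq.
Qed.

(* E(S), with the multiplication of S and the subspace topology. *)
Definition idempotent_type : Type := set_type (idempotents S).
HB.instance Definition _ := SubChoice.on idempotent_type.

Lemma idempotents_closed : mulg_closed (mem (idempotents S)).
Proof. by move=> e f /set_mem ee /set_mem ff; apply/mem_set/mul_idem. Qed.
HB.instance Definition _ := SubChoice_isSubSemigroup.Build S
  (fun e => e \in idempotents S) idempotent_type idempotents_closed.

End Idempotents.
Arguments idempotent_type : clear implicits.

HB.instance Definition _ (S : inverseWithSemigroupTopologyType) :=
  Topological.copy (idempotent_type S) (set_type (idempotents S)).

(* A partial permutation is encoded by its graph. *)
Definition partial_injection (h : set (nat * nat)) : Prop :=
  (forall x y z, h (x, y) -> h (x, z) -> y = z) /\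
  (forall x y z, h (x, z) -> h (y, z) -> x = y).

Record partial_perm := PartialPerm {
  graph :> set (nat * nat);
  graphP : `[< partial_injection graph >]
}.
HB.instance Definition _ := [isSub for graph].
HB.instance Definition _ := [Choice of partial_perm by <:].

(* Composition of relations from left to right: first [h], then [k].  (The
   library's [h \; k] composes in the opposite order.) *)
Definition rel_comp (h k : set (nat * nat)) : set (nat * nat) :=
  [set xz | exists2 y, h (xz.1, y) & k (y, xz.2)].

Lemma rel_comp_partial_injection (h k : partial_perm) :
  `[< partial_injection (rel_comp h k) >].
Proof.
have /asboolP[hf hi] := graphP h; have /asboolP[kf ki] := graphP k.
apply/asboolP; split => x y z [u /= hu ku] [v /= hv kv].
  by apply: kf ku _; rewrite (hf _ _ _ hu hv).
by apply: hi hu _; rewrite (ki _ _ _ ku kv).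
Qed.

Definition pp_comp (h k : partial_perm) : partial_perm :=
  PartialPerm (rel_comp_partial_injection h k).

Lemma pp_compA : associative pp_comp.
Proof.
move=> h k l; apply: val_inj => /=; apply/seteqP; split => -[x y] /=.
  by move=> [u /= hu [v /= kv lv]]; exists v => //; exists u.
by move=> [u /= [v /= hv kv] lu]; exists v => //; exists u.
Qed.

HB.instance Definition _ := isSemigroup.Build partial_perm pp_compA.

Definition pp_subbase : set (set partial_perm) :=
  [set A | (exists x y, A = [set h : partial_perm | graph h (x, y)]) \/
           (exists x, A = [set h : partial_perm | ~ (graph h).`1 x]) \/
           (exists x, A = [set h : partial_perm | ~ (graph h).`2 x])].

HB.instance Definition _ :=
  @isSubBaseTopological.Build partial_perm (set partial_perm) pp_subbase id.

(* The inverse map is required to be continuous on the image of [phi] with its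
   subspace topology, i.e. on the type [set_type (range phi)]. *)
Definition topological_embedding (S T : preTopologicalSemigroupType)
    (phi : {multiplicative S -> T}) : Prop :=
  [/\ injective phi, continuous phi &
      exists psi : set_type (range phi) -> S,
        (forall y, phi (psi y) = \val y) /\ continuous psi].

Definition embeds_topologically (S T : preTopologicalSemigroupType) : Prop :=
  exists phi : {multiplicative S -> T}, topological_embedding phi.

Section Polish.
Local Open Scope ring_scope.

Definition completely_metrizable (R : realType) (T : topologicalType) : Prop :=
  exists d : T -> T -> R,
    [/\ (forall x y, 0 <= d x y) /\ (forall x y, d x y = 0 <-> x = y),
        forall x y, d x y = d y x,
        forall x y z, d x z <= d x y + d y z,
        forall x : T,
          nbhs x = filter_from [set e : R | 0 < e] (fun e => [set y | d x y < e]) &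
        forall u : nat -> T,
          (forall e : R, 0 < e -> exists N : nat, forall m n : nat,
              (N <= m)%N -> (N <= n)%N -> d (u m) (u n) < e) ->
          exists l : T, u @ \oo --> l].

Definition separable (T : topologicalType) : Prop :=
  exists2 D : set T, countable D & dense D.

(* The choice of the real numbers [R] is immaterial. *)
Definition polish (R : realType) (T : topologicalType) : Prop :=
  completely_metrizable R T /\ separable T.

End Polish.

(* Main.v *)
From HB Require Import structures.
Require Import Defs.
From mathcomp Require Import all_boot all_order all_algebra finmap.
From mathcomp Require Import all_classical all_reals all_analysis.

(** Idempotents of the symmetric inverse monoid are partial identities, that is
    subsets of nat with intersection as product. So an embedding of the
    semilattice E(S) is the same thing as a sequence of clopen filters of E(S)
    which, with their complements, generate its topology. Pulled back along the
    map from s to s * sinv s, a filter becomes a face: a subsemigroup of S whose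
    complement is an ideal.

    From E(S) to S. A face F gives a congruence [germ_eq F]: a and b are
    identified when e * a = e * b for some idempotent e of F. Elements of F act
    on S / germ_eq F by right multiplication, and this action is by
    permutations, because idempotents are central in a Clifford semigroup and
    those of F become trivial in the quotient. Letting elements outside F act as
    the empty map turns S / germ_eq F into a representation of S by partial
    permutations. The representation [germ_rep] is the disjoint union of these
    over all finite intersections F of the given faces.

    Continuity needs the germ class of s to be a neighbourhood of s, for each s
    in F ([near_germ]). This is where Polishness enters: a countable completely
    metrizable space has no nonempty subset without isolated points
    ([has_isolated_point]). If d is an isolated point of the part of F below
    s * sinv s, then the idempotent e = d * sinv d of F satisfies e * u = e * s
    for all u near s, because translation carries such u into a neighbourhood
    of d that meets this part only in d.

    The inverse is continuous because S is ditopological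
    ([germ_rep_reflects_nbhs]). Given a neighbourhood O of s, with U and W as in
    the definition of ditopological, a finite cell of faces and complements of
    faces forces idempotents into W; if t lies in that cell and has the germ of
    s along the intersection of the faces in the cell, then e * t = e * s for an
    idempotent e of W, and t is in O. Injectivity follows, as S is Hausdorff.

    Conversely, neighbourhoods of the three subbasic kinds can be pulled back
    along an embedding. Points outside the domain of h are controlled by
    h * sinv h, and points outside its image by sinv h * h; the latter is the
    same idempotent when S is Clifford, which gives the neighbourhood W required
    by the definition ([embeddable_ditopological]). *)

Set Implicit Arguments.
Unset Strict Implicit.
Unset Printing Implicit Defensive.

Local Open Scope classical_set_scope.
Local Open Scope group_scope.

(** * Convergence and embeddings into the symmetric inverse monoid *)

(** Continuity of maps into [partial_perm], and the extraction of finitely many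
    subbasic conditions from a neighbourhood, are both instances of this: for
    the latter, take for F the sets that contain such a finite intersection. *)
Lemma cvg_partial_perm (F : set_system partial_perm) {FF : Filter F}
    (h : partial_perm) :
  (forall x y, graph h (x, y) -> F [set k | graph k (x, y)]) ->
  (forall x, ~ (graph h).`1 x -> F [set k | ~ (graph k).`1 x]) ->
  (forall y, ~ (graph h).`2 y -> F [set k | ~ (graph k).`2 y]) ->
  F --> h.
Proof.
move=> FU FW FV A; rewrite nbhsE => -[B [[D sD defB] Bh] sBA].
move: Bh; rewrite -defB => -[C DC Ch].
apply: (@filterS _ F _ C); first by move=> k Ck; apply/sBA; rewrite -defB; exists C.
have [I sI defC] := sD _ DC; move: Ch; rewrite -defC => Ch.
apply: filter_bigI => V IV; have /set_mem := sI _ IV; have := Ch _ IV.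
by move=> Vh [[x [y VE]]|[[x VE]|[x VE]]]; rewrite /id VE in Vh *;
  [apply: FU|apply: FW|apply: FV].
Qed.

Section PartialPerm.
Implicit Types (h k : partial_perm) (x y : nat).

Lemma near_graph h x y : graph h (x, y) -> \forall k \near h, graph k (x, y).
Proof.
move=> hxy; apply: (@open_nbhs_nbhs _ h [set k | graph k (x, y)]); split => //.
exists [set [set k : partial_perm | graph k (x, y)]]; last by rewrite bigcup_set1.
by move=> _ ->; apply: (@finI_from1 (set partial_perm)); left; exists x, y.
Qed.

Lemma near_notin_dom h x : ~ (graph h).`1 x -> \forall k \near h, ~ (graph k).`1 x.
Proof.
move=> hx; apply: (@open_nbhs_nbhs _ h [set k : partial_perm | ~ (graph k).`1 x]).
split => //.
exists [set [set k : partial_perm | ~ (graph k).`1 x]]; last by rewrite bigcup_set1.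
by move=> _ ->; apply: (@finI_from1 (set partial_perm)); right; left; exists x.
Qed.

Lemma near_notin_im h y : ~ (graph h).`2 y -> \forall k \near h, ~ (graph k).`2 y.
Proof.
move=> hy; apply: (@open_nbhs_nbhs _ h [set k : partial_perm | ~ (graph k).`2 y]).
split => //.
exists [set [set k : partial_perm | ~ (graph k).`2 y]]; last by rewrite bigcup_set1.
by move=> _ ->; apply: (@finI_from1 (set partial_perm)); right; right; exists y.
Qed.

Lemma graph_fun h x y z : graph h (x, y) -> graph h (x, z) -> y = z.
Proof. by have /asboolP[hf _] := graphP h; apply: hf. Qed.

Lemma graph_inj h x y z : graph h (x, z) -> graph h (y, z) -> x = y.
Proof. by have /asboolP[_ hi] := graphP h; apply: hi. Qed.

Lemma graph_idem h x y : h * h = h -> graph h (x, y) -> x = y.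
Proof.
move=> hh hxy; have : graph (h * h) (x, y) by rewrite hh.
by case=> z /= hxz hzy; rewrite (graph_inj hxy hzy) (graph_fun hxy hxz).
Qed.

(** Holds for any pair of mutually inverse elements, so a homomorphism into
    [partial_perm] is known on [sinv s] once it is known on [s]. *)
Lemma graph_sinv h k x y : h * k * h = h -> k * h * k = k ->
  graph k (x, y) <-> graph h (y, x).
Proof.
suff sub h' k' u v : h' * k' * h' = h' -> graph h' (v, u) -> graph k' (u, v).
  by move=> hkh khk; split; apply: sub.
move=> hkh huv; have : graph (h' * k' * h') (v, u) by rewrite hkh.
case=> w /= [z /= hvz kzw] hwu.
by rewrite (graph_fun huv hvz) (graph_inj huv hwu).
Qed.

End PartialPerm.

Section Embedding.
Variables S T : preTopologicalSemigroupType.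

(** Trades the continuous inverse on the subspace [range phi] for a condition on
    neighbourhoods, in which the subtype no longer occurs. *)
Lemma topological_embeddingP (phi : {multiplicative S -> T}) :
  topological_embedding phi <->
  [/\ injective phi, continuous phi &
      forall s O, nbhs s O ->
        exists2 V, nbhs (phi s) V & phi @^-1` V `<=` O].
Proof.
split=> [[phi_inj phi_cont [psi [psiK psi_cont]]]|[phi_inj phi_cont phi_refl]].
  split=> // s O sO.
  have rs t : phi t \in range phi by apply/mem_set; exists t.
  pose r t : set_type (range phi) := SigSub (rs t).
  have rK t : psi (r t) = t by apply: phi_inj; rewrite psiK.
  have : nbhs (r s) (psi @^-1` O) by apply: psi_cont; rewrite rK.
  rewrite nbhsE => -[B [[C oC defB] Bs] sBO]; exists C.
    by apply: open_nbhs_nbhs; split => //; move: Bs; rewrite -defB.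
  by move=> t Ct; rewrite -(rK t); apply: sBO; rewrite -defB.
split=> //.
have /choice[psi psiK] (y : set_type (range phi)) : exists s, phi s = \val y.
  by case: y => y yr /=; have [s _ <-] := set_mem yr; exists s.
exists psi; split => // y O /phi_refl[V]; rewrite psiK => yV sVO.
have : nbhs y (\val @^-1` V) by apply: initial_continuous.
by apply: (@filterS _ _ (nbhs_filter y)) => z Vz; apply: sVO; rewrite /= psiK.
Qed.

End Embedding.

(** * Inverse and Clifford semigroups *)

Section InverseSemigroup.
Variable S : inverseSemigroupType.
Implicit Types e f s t : S.

Lemma mulsV_idem s : s * sinv s * (s * sinv s) = s * sinv s.
Proof. by rewrite mulgA mulgVKs. Qed.

Lemma mulVs_idem s : sinv s * s * (sinv s * s) = sinv s * s.
Proof. by rewrite mulgA mulVgKs. Qed.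

(** Both e * f and f * e are inverses of the idempotent e * f. *)
Lemma idem_comm e f : e * e = e -> f * f = f -> e * f = f * e.
Proof.
move=> ee ff; have efef := mul_idem ee ff; have fefe := mul_idem ff ee.
rewrite -[LHS](sinv_idem efef); apply/esym/sinv_uniq.
  by rewrite -[RHS]efef !mulgA -(mulgA e f f) ff -(mulgA _ e e) ee.
by rewrite -[RHS]fefe !mulgA -(mulgA f e e) ee -(mulgA _ f f) ff.
Qed.

Lemma sinvM s t : sinv (s * t) = sinv t * sinv s.
Proof.
have C : t * sinv t * (sinv s * s) = sinv s * s * (t * sinv t).
  by apply: idem_comm; rewrite ?mulsV_idem ?mulVs_idem.
apply/esym/sinv_uniq.
  have -> : s * t * (sinv t * sinv s) * (s * t) =
      s * (t * sinv t * (sinv s * s)) * t by rewrite !mulgA.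
  by rewrite C !mulgA mulgVKs -(mulgA s) -(mulgA s) mulgVKs.
have -> : sinv t * sinv s * (s * t) * (sinv t * sinv s) =
    sinv t * (sinv s * s * (t * sinv t)) * sinv s by rewrite !mulgA.
by rewrite -C !mulgA mulVgKs -(mulgA (sinv t)) -(mulgA (sinv t)) mulVgKs.
Qed.

Hypothesis S_clifford : clifford S.

(** For x = e * s the equation x * sinv x = sinv x * x reads
    e * (s * sinv s) = sinv s * e * s; then multiply by s on the left. *)
Lemma idem_central e s : e * e = e -> e * s = s * e.
Proof.
move=> ee; have C := idem_comm ee (mulsV_idem s).
have E : e * (s * sinv s) = sinv s * e * s.
  have := S_clifford (e * s); rewrite sinvM (sinv_idem ee).
  rewrite !mulgA -(mulgA _ e e) ee -(mulgA _ s) -(mulgA _ (s * _)) -C.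
  by rewrite !mulgA ee -!mulgA.
have -> : e * s = s * (e * (s * sinv s)).
  by rewrite E -{1}(mulgVKs s) mulgA C !mulgA.
by rewrite C S_clifford !mulgA mulgVKs.
Qed.

End InverseSemigroup.

(** * Countable completely metrizable spaces *)

Section CompletelyMetrizable.
Local Open Scope ring_scope.
Import Order.TTheory GRing.Theory Num.Theory.
Variables (R : realType) (T : topologicalType).

(** Baire category: in a nonempty D without isolated points one can choose
    nested balls centred in D, of radius tending to 0, the n-th one avoiding the
    n-th point of the space. Their centres converge to a point of the space
    which is avoided by some ball that contains it. *)
Lemma has_isolated_point (D : set T) :
  completely_metrizable R T -> countable [set: T] -> D !=set0 ->
  exists2 x, D x & \forall y \near x, D y -> y = x.
Proof.
move=> [d [[d_ge0 d0] dC d_tri nbhs_d d_complete]] /countable_injP[c c_inj] [x0 Dx0].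
have dxx x : d x x = 0 by apply/d0.
have d_gt0 x y : x <> y -> 0 < d x y.
  by move=> xy; rewrite lt_neqAle d_ge0 andbT eq_sym; apply/eqP => /d0.
apply: contrapT => no_iso.
(* A state (n, (p, r)) stands for the closed ball of centre p and radius r,
   constructed after n steps. *)
have step (z : nat * (T * R)) : exists z' : nat * (T * R),
    D z.2.1 /\ 0 < z.2.2 ->
    [/\ z'.1 = z.1.+1, D z'.2.1 /\ 0 < z'.2.2, z'.2.2 <= z.1.+1%:R^-1,
        forall y, d z'.2.1 y <= z'.2.2 -> d z.2.1 y <= z.2.2 &
        forall y, c y = z.1 -> z'.2.2 < d z'.2.1 y].
  case: z => n [p r] /=.
  have [[Dp r_gt0]|nDr] := pselect (D p /\ 0 < r); last by exists (n, (p, r)).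
  have [q [Dq qp pqr]] : exists q, [/\ D q, q <> p & d p q < r].
    apply: contrapT => noq; apply: no_iso; exists p => //.
    suff : nbhs p [set y | D y -> y = p] by [].
    rewrite nbhs_d; exists r => //= y pyr Dy; apply: contrapT => yp.
    by apply: noq; exists y.
  have [p' [Dp' pp'r p'n]] : exists p', [/\ D p', d p p' < r & c p' <> n].
    have [cpn|] := pselect (c p = n); last by move=> ?; exists p; rewrite dxx.
    exists q; split=> // cqn; apply: qp.
    by apply: c_inj; rewrite ?in_setT // cpn.
  have [m m_gt0 p'm] : exists2 m, 0 < m & forall y, c y = n -> m < d p' y.
    have [[y cyn]|noy] := pselect (exists y, c y = n).
      exists (d p' y / 2).
        by rewrite divr_gt0 // d_gt0 // => p'y; apply: p'n; rewrite p'y.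
      move=> y'; rewrite -cyn => /c_inj; rewrite !in_setT => -> //.
      rewrite ltr_pdivrMr // ltr_pMr ?ltr1n //.
      by apply: d_gt0 => p'y; apply: p'n; rewrite p'y.
    by exists 1 => // y cyn; case: noy; exists y.
  exists (n.+1, (p', Num.min (Num.min m (r - d p p')) n.+1%:R^-1)) => _.
  split=> //=.
  - by split=> //; rewrite !lt_min m_gt0 subr_gt0 pp'r invr_gt0 ltr0n.
  - by rewrite ge_min lexx orbT.
  - move=> y; rewrite !le_min => /andP[/andP[_ yr] _].
    by rewrite (le_trans (d_tri _ p' _)) // -lerBrDl.
  - by move=> y /p'm; apply: le_lt_trans; rewrite !ge_min lexx.
have [z [z0 zS]] := dependent_choice (fun z => cid (step z)) (0%N, (x0, 1)).
pose p n := (z n).2.1; pose r n := (z n).2.2.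
have zP n : (z n).1 = n /\ (D (p n) /\ 0 < r n).
  elim: n => [|n [zn Drn]]; first by rewrite /p /r z0.
  by have [-> ? _ _ _] := zS n Drn; rewrite zn.
have r_le n : r n.+1 <= n.+1%:R^-1.
  by have [zn Drn] := zP n; have [_ _ + _ _] := zS n Drn; rewrite zn.
have ballS n y : d (p n.+1) y <= r n.+1 -> d (p n) y <= r n.
  by have [zn Drn] := zP n; have [_ _ _ + _] := zS n Drn; apply.
have avoid n y : c y = n -> r n.+1 < d (p n.+1) y.
  by have [zn Drn] := zP n; have [_ _ _ _ +] := zS n Drn; rewrite zn; apply.
have ball_p n k : d (p n) (p (n + k)%N) <= r n.
  suff : forall y, d (p (n + k)%N) y <= r (n + k)%N -> d (p n) y <= r n.
    by apply; rewrite dxx; have [_ [_ /ltW]] := zP (n + k)%N.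
  by elim: k => [|k IH] y; [rewrite addn0|rewrite addnS => /ballS/IH].
have ball_le n m : (n <= m)%N -> d (p n) (p m) <= r n.
  by move=> nm; rewrite -(subnKC nm).
have [l p_l] : exists l : T, p @ \oo --> l.
  apply: d_complete => e e_gt0.
  have [N Ne] : exists N, N.+1%:R^-1 < e / 2.
    exists (Num.bound (2 / e)).
    rewrite invf_plt ?posrE ?ltr0n // ?divr_gt0 // invf_div.
    have := archi_boundP (ltW (divr_gt0 (ltr0n R 2) e_gt0)).
    by move/lt_trans; apply; rewrite ltr_nat.
  exists N.+1 => m n Nm Nn; rewrite (splitr e).
  rewrite (le_lt_trans (d_tri _ (p N.+1) _)) // dC ltrD //.
    exact: le_lt_trans (le_trans (ball_le _ _ Nm) (r_le N)) Ne.
  exact: le_lt_trans (le_trans (ball_le _ _ Nn) (r_le N)) Ne.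
have [e e_gt0 lE] : exists2 e, 0 < e & d (p (c l).+1) l = r (c l).+1 + e.
  exists (d (p (c l).+1) l - r (c l).+1); last by rewrite addrC subrK.
  by rewrite subr_gt0 avoid.
have /p_l[N _ Ne] : nbhs l [set y | d l y < e] by rewrite nbhs_d; exists e.
pose m := maxn N (c l).+1.
have := d_tri (p (c l).+1) (p m) l; rewrite leNgt => /negP; apply.
rewrite lE ler_ltD ?ball_le ?leq_maxr // dC.
exact: (Ne m (leq_maxl _ _)).
Qed.

Lemma completely_metrizable_sep (x y : T) :
  completely_metrizable R T -> (forall O, nbhs x O -> O y) -> x = y.
Proof.
move=> [d [[d_ge0 d0] _ _ nbhs_d _]] xy; apply/d0/eqP; apply: contraT => dxy.
have : [set z | d x z < d x y] y.
  by apply: xy; rewrite nbhs_d; exists (d x y) => //=; rewrite lt_neqAle eq_sym dxy d_ge0.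
by rewrite /= ltxx.
Qed.

End CompletelyMetrizable.

(** * Embeddable Clifford semigroups are ditopological *)

Section EmbeddableIsDitopological.
Variables (S : inverseWithSemigroupTopologyType).
Variable phi : {multiplicative S -> partial_perm}.
Implicit Types (e s t : S) (x y : nat).

Lemma graph_morph_sinv s x y :
  graph (phi (sinv s)) (x, y) <-> graph (phi s) (y, x).
Proof. by apply: graph_sinv; rewrite -!gmulfM ?mulgVKs ?mulVgKs. Qed.

Lemma dom_morph_mulsV s x : (graph (phi (s * sinv s))).`1 x <-> (graph (phi s)).`1 x.
Proof.
rewrite gmulfM; split=> [[y [z /= sxz _]]|[y sxy]]; first by exists z.
by exists x, y => //=; apply/graph_morph_sinv.
Qed.

Lemma dom_morph_mulVs s y : (graph (phi (sinv s * s))).`1 y <-> (graph (phi s)).`2 y.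
Proof.
rewrite gmulfM; split=> [[x [z /= /graph_morph_sinv szy _]]|[x sxy]]; first by exists z.
by exists y, x => //=; apply/graph_morph_sinv.
Qed.

Hypothesis phi_emb : topological_embedding phi.

(** Passing to the converse graph permutes the subbasic sets. *)
Lemma embeddable_sinv_continuous : continuous (@sinv S).
Proof.
have /topological_embeddingP[_ phi_cont phi_refl] := phi_emb.
move=> s O /phi_refl[V sV /filterS]; apply.
suff /(_ V sV) : phi \o @sinv S @ s --> phi (sinv s) by [].
apply: cvg_partial_perm => [x y|x|y].
- move=> /graph_morph_sinv /near_graph /phi_cont near_s.
  apply: (@filterS _ (nbhs s)) near_s => t /= tyx.
  exact/graph_morph_sinv.
- move=> sx; have /near_notin_im/phi_cont near_s : ~ (graph (phi s)).`2 x.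
    by move=> [y /graph_morph_sinv sxy]; apply: sx; exists y.
  apply: (@filterS _ (nbhs s)) near_s => t tx [y /graph_morph_sinv tyx].
  by apply: tx; exists y.
- move=> sy; have /near_notin_dom/phi_cont near_s : ~ (graph (phi s)).`1 y.
    by move=> [x /graph_morph_sinv sxy]; apply: sy; exists x.
  apply: (@filterS _ (nbhs s)) near_s => t ty [x /graph_morph_sinv tyx].
  by apply: ty; exists x.
Qed.

(** It suffices to find U and W for the three subbasic kinds of neighbourhoods
    of phi s. If b = e * t with e idempotent then the graph of phi b is
    contained in that of phi t, so U alone handles membership of a pair in the
    graph. Domain conditions on t only depend on t * sinv t, hence are handled
    by W; so are image conditions, as sinv t * t = t * sinv t. *)
Lemma embeddable_ditopological : clifford S -> ditopological S.
Proof.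
move=> S_clifford; split; first exact: embeddable_sinv_continuous.
have /topological_embeddingP[_ phi_cont phi_refl] := phi_emb.
pose N (U W : set S) := [set s : S | exists b e : S,
  [/\ U b, (W `&` idempotents S) e & b = e * s]] `&` [set s : S | W (s * sinv s)].
have subN U U' W W' : U `<=` U' -> W `<=` W' -> N U W `<=` N U' W'.
  move=> UU' WW' s [[b [e [Ub [We ee] bE]]] Ws]; split; last exact: WW'.
  by exists b, e; split; [exact: UU'|split; [exact: WW'|]|].
move=> s O /phi_refl[V]; pose F : set_system partial_perm := [set V | exists U W,
  [/\ nbhs s U, nbhs (s * sinv s) W & N U W `<=` phi @^-1` V]].
have FF : Filter F.
  split.
  - by exists setT, setT; split; [exact: filterT|exact: filterT|].
  - move=> A B [U [W [sU sW UW]]] [U' [W' [sU' sW' UW']]].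
    exists (U `&` U'), (W `&` W'); split; [exact: filterI|exact: filterI|].
    move=> t tN; split; [apply: UW|apply: UW']; move: tN; apply: subN => ? [] //.
  - by move=> A B AB [U [W [sU sW UW]]]; exists U, W; split => // t /UW/AB.
suff /(_ V) FV : F --> phi s.
  by move=> /FV[U [W [sU sW UW]]] VO; exists U, W; split => // t /UW/VO.
have FW x V' : ~ (graph (phi (s * sinv s))).`1 x ->
    (forall t, ~ (graph (phi (t * sinv t))).`1 x -> V' (phi t)) -> F V'.
  move=> sx V'x; exists setT, (phi @^-1` [set k | ~ (graph k).`1 x]).
  split; [exact: filterT|exact/phi_cont/near_notin_dom|].
  by move=> t [_ /= tx]; exact: V'x.
apply: cvg_partial_perm => [x y sxy|x sx|y sy].
- exists (phi @^-1` [set k | graph k (x, y)]), setT.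
  split; [exact/phi_cont/near_graph|exact: filterT|].
  move=> t [[b [e [+ [_ ee] bE]]] _] /=; rewrite bE /= gmulfM => -[z /= exz tzy].
  by rewrite (graph_idem _ exz) // -gmulfM ee.
- by apply: (FW x) => [/dom_morph_mulsV//|t tx /= /dom_morph_mulsV//].
- apply: (FW y) => [|t ty] /=; first by rewrite S_clifford => /dom_morph_mulVs.
  by move=> /dom_morph_mulVs; rewrite -S_clifford.
Qed.

Lemma embeddable_idempotents : embeds_topologically (idempotent_type S) partial_perm.
Proof.
have /topological_embeddingP[phi_inj phi_cont phi_refl] := phi_emb.
pose iota : {multiplicative idempotent_type S -> S} := \val.
exists (phi \o iota); apply/topological_embeddingP; split.
- by move=> e f /phi_inj/val_inj.
- move=> e; apply: continuous_comp; last exact: phi_cont.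
  exact: initial_continuous.
- move=> e O; rewrite nbhsE => -[_ [[B oB <-] Be] BO].
  have /phi_refl[V eV VB] : nbhs (\val e) B by exact: open_nbhs_nbhs.
  by exists V => // f Vf; apply/BO/VB.
Qed.

End EmbeddableIsDitopological.

(** * Faces and germs *)

Section Faces.
Variable S : inverseSemigroupType.
Implicit Types (F : set S) (a b e s t : S).

Definition face F := forall s t, F (s * t) <-> F s /\ F t.

Lemma face_mulsV F s : face F -> F (s * sinv s) <-> F s.
Proof.
by move=> FM; split=> [/FM[]//|Fs]; move: Fs; rewrite -{1}(mulgVKs s) => /FM[].
Qed.

Lemma face_sinv F s : face F -> F s -> F (sinv s).
Proof. by move=> FM /(face_mulsV s FM)/FM[]. Qed.

Lemma face_bigcap (A : nat -> set S) (L : set nat) :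
  (forall x, face (A x)) -> face (\bigcap_(x in L) A x).
Proof.
move=> AM s t; split=> [Ast|[As At] x Lx].
  by split=> x Lx; have /AM[] := Ast x Lx.
by apply/AM; split; [apply: As|apply: At].
Qed.

(** The congruence whose quotient makes the idempotents of F trivial. *)
Definition germ_eq F a b := exists e, [/\ e * e = e, F e & e * a = e * b].

Lemma germ_eq_refl F s a : face F -> F s -> germ_eq F a a.
Proof.
by move=> FM Fs; exists (s * sinv s); rewrite mulsV_idem; split=> //; apply/face_mulsV.
Qed.

Lemma germ_eq_sym F a b : germ_eq F a b -> germ_eq F b a.
Proof. by move=> [e [ee Fe eab]]; exists e. Qed.

Lemma germ_eq_trans F a b t : face F ->
  germ_eq F a b -> germ_eq F b t -> germ_eq F a t.
Proof.
move=> FM [e [ee Fe eab]] [f [ff Ff fbt]]; exists (e * f); split.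
- exact: mul_idem.
- exact/FM.
- by rewrite {1}(idem_comm ee ff) -!mulgA -fbt eab !mulgA (idem_comm ee ff).
Qed.

Lemma germ_eqMr F a b s : germ_eq F a b -> germ_eq F (a * s) (b * s).
Proof. by move=> [e [ee Fe eab]]; exists e; rewrite !mulgA eab. Qed.

Hypothesis S_clifford : clifford S.

(** With [germ_eqMr_inv]: right multiplication by an element of F is a
    permutation of the germs. *)
Lemma germ_eq_mulVsK F a s : face F -> F s -> germ_eq F a (a * sinv s * s).
Proof.
move=> FM Fs; have ff := mulsV_idem s; exists (s * sinv s); split=> //.
  exact/face_mulsV.
by rewrite -(mulgA a) -S_clifford -(idem_central S_clifford a ff) [RHS]mulgA ff.
Qed.

Lemma germ_eqMr_inv F a b s : face F -> F s ->
  germ_eq F (a * s) (b * s) -> germ_eq F a b.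
Proof.
move=> FM Fs /(germ_eqMr (sinv s)) abs.
have K t : germ_eq F t (t * s * sinv s).
  by rewrite -mulgA S_clifford mulgA; exact: germ_eq_mulVsK.
exact: germ_eq_trans FM (K a) (germ_eq_trans FM abs (germ_eq_sym (K b))).
Qed.

End Faces.

Section TopologicalSemigroup.
Variable S : topologicalSemigroupType.

Lemma cvg_mul (X : Type) (G : set_system X) {FG : Filter G} (f g : X -> S) s t :
  f @ G --> s -> g @ G --> t -> f x * g x @[x --> G] --> s * t.
Proof.
move=> fs gt.
exact: (cvg_comp _ _ (cvg_pair fs gt) (@smul_continuous S (s, t))).
Qed.

End TopologicalSemigroup.

Section NearGerm.
Variables (R : realType) (S : inverseWithSemigroupTopologyType).
Hypotheses (S_clifford : clifford S) (S_countable : countable [set: S]).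
Hypothesis S_complete : completely_metrizable R S.

(** Let f = s * sinv s. The set of all t in F with f * t = t contains s, so it
    has an isolated point d. The map from u to f * u * sinv s * d sends s to d
    and a neighbourhood of s into this set, hence takes the value d near s. The
    equation f * u * sinv s * d = d then gives e * u = e * s for
    e = d * sinv d. *)
Lemma near_germ (F : set S) s : face F -> open F -> F s ->
  exists e, [/\ e * e = e, F e & \forall u \near s, e * u = e * s].
Proof.
move=> FM oF Fs; have [f fE] : exists f, f = s * sinv s by exists (s * sinv s).
have ff : f * f = f by rewrite fE mulsV_idem.
have fs : f * s = s by rewrite fE mulgVKs.
have Ff : F f by rewrite fE; apply/face_mulsV.
have [d [Fd fd] d_iso] : exists2 d, F d /\ f * d = d &
    \forall t \near d, F t /\ f * t = t -> t = d.
  by apply: (has_isolated_point S_complete S_countable); exists s.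
have [e eE] : exists e, e = d * sinv d by exists (d * sinv d).
have ee : e * e = e by rewrite eE mulsV_idem.
have fe : f * e = e by rewrite eE mulgA fd.
exists e; split; [exact: ee|by rewrite eE; apply/face_mulsV|].
have psi_cvg : f * u * sinv s * d @[u --> s] --> d.
  have -> : nbhs d = nbhs (f * s * sinv s * d) by rewrite fs -fE fd.
  by do 3?[apply: cvg_mul]; first [exact: cvg_cst|exact: cvg_id].
have Fnear : \forall u \near s, F u by exact: open_nbhs_nbhs.
have psi_near := psi_cvg _ d_iso.
near=> u.
have psi_u : f * u * sinv s * d = d.
  have Fu : F u by near: u.
  have : F (f * u * sinv s * d) /\ f * (f * u * sinv s * d) = f * u * sinv s * d ->
    f * u * sinv s * d = d by near: u.
  apply; split; last by rewrite !mulgA ff.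
  apply/FM; split=> //; apply/FM; split; [exact/FM|exact: face_sinv].
(* Multiply psi_u by sinv d * s on the right. *)
rewrite (_ : e * s = f * u * sinv s * d * sinv d * s); last by rewrite psi_u eE.
rewrite -(mulgA _ d) -eE -(mulgA _ e) (idem_central S_clifford s ee).
rewrite !mulgA -(mulgA _ (sinv s)) -S_clifford -fE.
rewrite (idem_central S_clifford u ff) -(mulgA u f f) ff -(mulgA u) fe.
exact: idem_central.
Unshelve. all: by end_near.
Qed.

End NearGerm.

(** * Faces from an embedding of the semilattice *)

Definition face_cell (S : Type) (A : nat -> set S) (L M : {fset nat}) : set S :=
  \bigcap_(x in [set` L]) A x `&` \bigcap_(x in [set` M]) ~` A x.

Lemma face_cellU (S : Type) (A : nat -> set S) L L' M M' :
  face_cell A (L `|` L')%fset (M `|` M')%fset = face_cell A L M `&` face_cell A L' M'.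
Proof. by rewrite /face_cell !set_fsetU !bigcap_setU setIACA. Qed.

(** Neighbourhoods are only required to absorb the idempotents of a cell: this
    is a statement about the topology of E(S). *)
Definition faces_generate (S : inverseWithSemigroupTopologyType) (A : nat -> set S) :=
  forall s W, nbhs (s * sinv s) W -> exists L M,
    face_cell A L M s /\ face_cell A L M `&` idempotents S `<=` W.

Section FacesOfSemilattice.
Variable S : inverseWithSemigroupTopologyType.
Hypothesis S_clifford : clifford S.
Hypothesis sinv_continuous : continuous (@sinv S).
Implicit Types (s t : S) (e : idempotent_type S).

Definition mulsV s : idempotent_type S := SigSub (mem_set (mulsV_idem s)).

Lemma mulsVM s t : mulsV (s * t) = mulsV s * mulsV t.
Proof.
apply: val_inj => /=; rewrite sinvM !mulgA -(mulgA s t).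
rewrite -(mulgA s) -(mulgA s).
rewrite [t * _ * _](idem_central S_clifford _ (mulsV_idem t)).
by rewrite !mulgA.
Qed.

Lemma mulsV_val e : mulsV (\val e) = e.
Proof.
apply: val_inj => /=; have /set_mem ee := valP e.
by rewrite (sinv_idem ee).
Qed.

Lemma mulsV_continuous : continuous mulsV.
Proof.
move=> s O; rewrite nbhsE => -[_ [[B oB <-] Bs] BO].
have : nbhs s [set t | B (t * sinv t)].
  apply: (cvg_mul (f := id) (g := @sinv S) (s := s) (t := sinv s)).
  - exact: cvg_id.
  - exact: sinv_continuous.
  - exact: open_nbhs_nbhs.
by apply: filterS => t Bt; apply: BO.
Qed.

(** An idempotent partial permutation is a partial identity, so membership of
    the point x in its domain is multiplicative and defines a face. *)
Lemma faces_of_semilattice :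
  embeds_topologically (idempotent_type S) partial_perm ->
  exists A : nat -> set S, [/\ forall x, face (A x), forall x, clopen (A x)
    & faces_generate A].
Proof.
move=> [phi /topological_embeddingP[_ phi_cont phi_refl]].
have phi_idem e x y : graph (phi e) (x, y) -> x = y.
  apply: graph_idem; rewrite -gmulfM; congr (phi _); apply: val_inj.
  by have /set_mem := valP e.
have phi_mulsV_cont : continuous (phi \o mulsV).
  by move=> s; apply: continuous_comp; [exact: mulsV_continuous|exact: phi_cont].
pose A x : set S := [set s | graph (phi (mulsV s)) (x, x)].
have A_dom x s : A x s <-> (graph (phi (mulsV s))).`1 x.
  by split=> [sx|[y sxy]]; [exists x|rewrite /A /= {2}(phi_idem _ _ _ sxy)].
have A_im x s : A x s <-> (graph (phi (mulsV s))).`2 x.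
  by split=> [sx|[y sxy]]; [exists x|rewrite /A /= -{1}(phi_idem _ _ _ sxy)].
exists A; split=> [x s t|x|s W sW].
- rewrite /A /= mulsVM gmulfM; split=> [[y /= sxy tyx]|[sx tx]]; last by exists x.
  by move: sxy tyx => /[dup]/phi_idem <-.
- split.
    by rewrite openE => s sx; exact: (phi_mulsV_cont s _ (near_graph sx)).
  rewrite -openC openE => s sx.
  have {}sx : ~ (graph (phi (mulsV s))).`1 x by rewrite -A_dom.
  apply: (@filterS _ (nbhs s)) (phi_mulsV_cont s _ (near_notin_dom sx)) => t tx.
  by move=> /A_dom.
have /phi_refl[V sV VW] : nbhs (mulsV s) (\val @^-1` W) by exact: initial_continuous.
(* The filter of the sets that contain the image of a cell around mulsV s. *)
pose F : set_system partial_perm := [set V | exists L M, face_cell A L M s /\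
  forall e, face_cell A L M (\val e) -> V (phi e)].
have FF : Filter F.
  split.
  - by exists fset0, fset0; split=> //; split=> x; rewrite /= inE.
  - move=> B C [L [M [sLM LMB]]] [L' [M' [sLM' LMC]]].
    exists (L `|` L')%fset, (M `|` M')%fset; rewrite face_cellU; split=> //.
    by move=> e [eLM eLM']; split; [apply: LMB|apply: LMC].
  - by move=> B C BC [L [M [sLM LMB]]]; exists L, M; split=> // e /LMB/BC.
have Fin x : A x s -> F [set h | graph h (x, x)].
  move=> sx; exists [fset x]%fset, fset0; split.
    by split=> y; rewrite /= inE // => /eqP->.
  by move=> e [/(_ x (fset11 x))]; rewrite /A /= mulsV_val.
have Fnotin x V' : ~ A x s -> (forall e, ~ A x (\val e) -> V' (phi e)) -> F V'.
  move=> sx V'x; exists fset0, [fset x]%fset; split.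
    by split=> y; rewrite /= inE // => /eqP->.
  by move=> e [_ /(_ x (fset11 x))]; exact: V'x.
have /(_ V sV)[L [M [sLM LMV]]] : F --> phi (mulsV s).
  apply: cvg_partial_perm => [x y sxy|x|y].
  - by have xy := phi_idem _ _ _ sxy; rewrite -xy in sxy *; exact: Fin.
  - by rewrite -A_dom => /Fnotin; apply=> e; rewrite A_dom mulsV_val.
  - by rewrite -A_im => /Fnotin; apply=> e; rewrite A_im mulsV_val.
exists L, M; split=> // e [eLM ee].
exact: (VW (SigSub (mem_set ee)) (LMV (SigSub (mem_set ee)) eLM)).
Qed.

End FacesOfSemilattice.

(** * The representation on germs *)

Section Representation.
Variables (R : realType) (S : inverseWithSemigroupTopologyType).
Variables (A : nat -> set S) (c : S -> nat).
Hypotheses (S_clifford : clifford S) (S_complete : completely_metrizable R S).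
Hypotheses (A_face : forall x, face (A x)) (A_clopen : forall x, clopen (A x)).
Hypothesis c_inj : injective c.
Implicit Types (L M : {fset nat}) (a b e s t : S).

Local Notation FL L := (\bigcap_(x in [set` L]) A x).

Lemma face_cell_near L M s : face_cell A L M s -> \forall t \near s, face_cell A L M t.
Proof.
move=> [sL sM]; apply: (@filterI _ (nbhs s)).
  apply: filter_bigI => x xL; apply: open_nbhs_nbhs.
  by split; [case: (A_clopen x)|apply: sL].
apply: filter_bigI => x xM; apply: open_nbhs_nbhs; split; last exact: sM.
by rewrite openC; case: (A_clopen x).
Qed.

Lemma face_cell_L0 L s : face_cell A L fset0 s <-> FL L s.
Proof. by split=> [[]//|sL]; split=> // x; rewrite /= inE. Qed.

Let face_F L : face (FL L). Proof. exact: face_bigcap. Qed.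

Lemma face_F_open L : open (FL L).
Proof.
rewrite openE => s /face_cell_L0/face_cell_near.
by apply: filterS => t /face_cell_L0.
Qed.

(** A pair of a finite set L and a germ along the face of L, as a number: the
    code of the class is the value that [xget] picks among the c b for b in the
    class, so that no quotient type is needed. The default value 0 is reached
    only when the face is empty. *)
Definition germ_code L a : nat := choice.pickle (L, xget 0%N (c @` germ_eq (FL L) a)).

Lemma germ_code_face L M a b : germ_code L a = germ_code M b -> L = M.
Proof. by move=> /(pcan_inj choice.pickleK)[]. Qed.

Lemma germ_codeP L s a b : FL L s -> germ_code L a = germ_code L b <-> germ_eq (FL L) a b.
Proof.
move=> Ls; split=> [/(pcan_inj choice.pickleK)[eq_ab]|ab].
  have code_in t : (c @` germ_eq (FL L) t) (xget 0%N (c @` germ_eq (FL L) t)).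
    by apply: xgetPex; exists (c t), t => //; exact: germ_eq_refl Ls.
  have [x ax xa] := code_in a; have [y bY yb] := code_in b.
  have xy : x = y by apply: c_inj; rewrite xa yb eq_ab.
  by rewrite -xy in bY; exact: germ_eq_trans ax (germ_eq_sym bY).
congr (choice.pickle (_, xget _ _)); apply/seteqP; split=> _ [t ht <-]; exists t => //.
  exact: germ_eq_trans (germ_eq_sym ab) ht.
exact: germ_eq_trans ab ht.
Qed.

Definition germ_act s : set (nat * nat) := [set p | exists L a,
  [/\ FL L s, p.1 = germ_code L a & p.2 = germ_code L (a * s)]].

Lemma germ_act_partial_injection s : `[< partial_injection (germ_act s) >].
Proof.
apply/asboolP; split=> x y z [L [a [Ls /= xE yE]]] [M [b [Ms /= xE' yE']]].
  have LM : L = M by exact: (germ_code_face (etrans (esym xE) xE')).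
  rewrite -LM in xE' yE'; rewrite yE yE'; apply/(germ_codeP _ _ Ls)/germ_eqMr.
  by apply/(germ_codeP _ _ Ls); rewrite -xE.
have LM : L = M by exact: (germ_code_face (etrans (esym yE) yE')).
rewrite -LM in xE' yE'; rewrite xE xE'; apply/(germ_codeP _ _ Ls).
apply: (germ_eqMr_inv S_clifford _ Ls) => //.
by apply/(germ_codeP _ _ Ls); rewrite -yE.
Qed.

Definition germ_rep s : partial_perm := PartialPerm (germ_act_partial_injection s).

Lemma germ_repM : {morph germ_rep : s t / s * t}.
Proof.
move=> s t; apply: val_inj => /=; apply/seteqP; split=> -[x y].
  move=> [L [a [/face_F[Ls Lt] /= xE yE]]].
  exists (germ_code L (a * s)); first by exists L, a.
  by exists L, (a * s); rewrite -mulgA.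
move=> [z [L [a [Ls /= xE zE]]] [M [b [Mt /= zE' yE]]]].
have LM : L = M by exact: (germ_code_face (etrans (esym zE) zE')).
rewrite -LM in Mt zE' yE; exists L, a; split=> //; first exact/face_F.
rewrite /= yE mulgA; apply/(germ_codeP _ _ Ls)/germ_eqMr.
by apply/(germ_codeP _ _ Ls); rewrite -zE zE'.
Qed.

HB.instance Definition _ := isMultiplicative.Build S partial_perm germ_rep germ_repM.

Lemma germ_rep_dom s x :
  (graph (germ_rep s)).`1 x <-> exists L a, FL L s /\ x = germ_code L a.
Proof.
split=> [[y [L [a [Ls /= xE _]]]]|[L [a [Ls ->]]]]; first by exists L, a.
by exists (germ_code L (a * s)), L, a.
Qed.

Lemma germ_rep_im s y :
  (graph (germ_rep s)).`2 y <-> exists L a, FL L s /\ y = germ_code L a.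
Proof.
split=> [[x [L [a [Ls /= _ yE]]]]|[L [a [Ls ->]]]]; first by exists L, (a * s).
exists (germ_code L (a * sinv s)), L, (a * sinv s); split=> //=.
by apply/(germ_codeP _ _ Ls)/germ_eq_mulVsK.
Qed.

Lemma germ_rep_domE s L a : (graph (germ_rep s)).`1 (germ_code L a) <-> FL L s.
Proof.
split=> [/germ_rep_dom[M [b [Ms /germ_code_face->]]]//|Ls].
by apply/germ_rep_dom; exists L, a.
Qed.

(** On the germs along the face F of L, s acts by a total permutation if s is
    in F and by the empty map otherwise. So the domain and the image vary
    continuously since faces are clopen, and the value at a given germ does by
    [near_germ]. *)
Lemma germ_rep_continuous : continuous germ_rep.
Proof.
have S_countable : countable [set: S].
  by apply/countable_injP; exists c => s t _ _; exact: c_inj.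
move=> s; have undef x : ~ (exists L a, FL L s /\ x = germ_code L a) ->
    \forall t \near s, ~ (exists L a, FL L t /\ x = germ_code L a).
  move=> sx; have [[L [a xE]]|nox] := pselect (exists L a, x = germ_code L a); last first.
    by apply: filterE => t [L [a [_ xE]]]; apply: nox; exists L, a.
  have /existsNP[y /not_implyP[yL sy]] : ~ FL L s by move=> Ls; apply: sx; exists L, a.
  have : \forall t \near s, ~ A y t.
    by apply: open_nbhs_nbhs; split => //; rewrite openC; case: (A_clopen y).
  apply: filterS => t ty [M [b [Mt xE']]]; apply/ty/Mt.
  by have <- : L = M by exact: (germ_code_face (etrans (esym xE) xE')).
apply: cvg_partial_perm => [x y [L [a [Ls /= xE yE]]]|x|y].
- have [e [ee Le near_e]] :=
    near_germ S_clifford S_countable S_complete (@face_F L) (@face_F_open L) Ls.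
  have near_L : \forall t \near s, FL L t.
    by apply: open_nbhs_nbhs; split=> //; exact: face_F_open.
  apply: (@filterS2 _ (nbhs s) _ _ _ _ _ near_e near_L) => t et Lt.
  exists L, a; split=> //=; rewrite yE; apply/(germ_codeP _ _ Ls).
  by exists e; rewrite !mulgA (idem_central S_clifford a ee) -!mulgA et.
- rewrite germ_rep_dom => /undef.
  by apply: filterS => t tx /germ_rep_dom.
- rewrite germ_rep_im => /undef.
  by apply: filterS => t tx /germ_rep_im.
Qed.

Hypotheses (A_generate : faces_generate A) (S_ditop : ditopological S).

(** With f = s * sinv s, near germ_rep s the germ of f along the face of L is
    still sent to that of s, which yields e * f * t = e * f * s for some e in
    the face. The cell is taken small enough that its idempotents g satisfy both
    W g and U (g * s); this applies to g = e * f, which avoids the faces in M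
    because it lies below f. *)
Lemma germ_rep_reflects_nbhs s O : nbhs s O ->
  exists2 V, nbhs (germ_rep s) V & germ_rep @^-1` V `<=` O.
Proof.
move=> sO; have [_ /(_ s O sO)[U [W [sU sW UWO]]]] := S_ditop.
have [f fE] : exists f, f = s * sinv s by exists (s * sinv s).
have ff : f * f = f by rewrite fE mulsV_idem.
have fs : f * s = s by rewrite fE mulgVKs.
have sW' : nbhs (s * sinv s) [set e | W e /\ U (e * s)].
  apply: (@filterI _ (nbhs (s * sinv s))) => //.
  apply: (cvg_mul (f := id) (g := fun=> s) (s := s * sinv s) (t := s)).
  - exact: cvg_id.
  - exact: cvg_cst.
  - by rewrite -fE fs.
have [L [M [[Ls Ms] LMW]]] := A_generate sW'.
have not_M e t x : x \in M -> e * f = e -> ~ A x e.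
  move=> xM ef; rewrite -ef => /A_face[_]; rewrite fE => /(face_mulsV s (A_face x)).
  exact: Ms.
exists ([set k | graph k (germ_code L f, germ_code L s)] `&`
    \bigcap_(x in [set` M]) [set k | ~ (graph k).`1 (germ_code [fset x]%fset s)]).
  apply: filterI; first by apply: near_graph; exists L, f; rewrite /= fs.
  apply: filter_bigI => x xM; apply: near_notin_dom => /germ_rep_domE sx.
  exact: (Ms x xM (sx x (fset11 x))).
move=> t [[L' [a [Lt /= fa sat]]] Mt].
have LL' : L = L' by exact: germ_code_face fa.
rewrite -LL' in Lt fa sat.
have [e [ee Le efts]] : germ_eq (FL L) (f * t) s.
  apply: (@germ_eq_trans _ _ _ (a * t)) => //.
    by apply/germ_eqMr/(germ_codeP _ _ Ls).
  by apply/germ_eq_sym/(germ_codeP _ _ Ls).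
have ef_idem : e * f * (e * f) = e * f := mul_idem ee ff.
have [Wef Uefs] : W (e * f) /\ U (e * f * s).
  apply: LMW; split => //; split.
    by apply/face_F; split=> //; rewrite fE; apply/face_mulsV.
  by move=> x xM; apply: not_M => //; rewrite -mulgA ff.
apply: UWO; split.
  exists (e * f * s), (e * f); split=> //.
  by rewrite -mulgA fs -efts mulgA.
have [] : W (t * sinv t) /\ U (t * sinv t * s); last by [].
apply: LMW; split; last exact: mulsV_idem.
split; first by apply/face_mulsV.
move=> x xM /(face_mulsV t (A_face x)) tx; apply: (Mt x xM).
by apply/germ_rep_domE => y; rewrite /= inE => /eqP->.
Qed.

Lemma germ_rep_embedding : topological_embedding germ_rep.
Proof.
apply/topological_embeddingP; split; first last.
- exact: germ_rep_reflects_nbhs.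
- exact: germ_rep_continuous.
move=> s t st; apply: (completely_metrizable_sep S_complete) => O.
move=> /germ_rep_reflects_nbhs[V /nbhs_singleton sV]; apply.
by rewrite /= -st.
Qed.

End Representation.

Theorem theorem2p7 (R : realType) (S : inverseWithSemigroupTopologyType)
    (S_clifford : clifford S) (S_countable : countable [set: S]%classic)
    (S_polish : polish R S) :
  embeds_topologically S partial_perm <->
  ditopological S /\ embeds_topologically (idempotent_type S) partial_perm.
Proof.
split=> [[phi phi_emb]|[S_ditop E_emb]].
  split; [exact: embeddable_ditopological phi_emb S_clifford|].
  exact: embeddable_idempotents phi_emb.
have [A [A_face A_clopen A_generate]] := faces_of_semilattice S_clifford S_ditop.1 E_emb.
have /countable_injP[c c_injT] := S_countable.
have c_inj : injective c by move=> s t; apply: c_injT; rewrite in_setT.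
exists (germ_rep S_clifford A_face c_inj).
by apply: germ_rep_embedding => //; exact: S_polish.1.
Qed.
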